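(* Let $a,b\in\mathbb{R}$ with $|a|\ge 1$ and $b>0$, and consider the two scalar discrete-time systems $S_1:\ x_{t+1}=a x_t+b u_t$ and $S_2:\ x_{t+1}=a x_t-b u_t$. Then the pair $(S_1,S_2)$ is co-stabilizable neither by a linear static state feedback controller nor by a linear dynamic state feedback controller (of any order $p\ge 0$).
   Context: A system $(\mathbf{A},\mathbf{B})$ with $\mathbf{A}\in\mathbb{R}^{n\times n}$, $\mathbf{B}\in\mathbb{R}^{n\times m}$ denotes the fully observed discrete-time linear time-invariant system $\mathbf{x}_{t+1}=\mathbf{A}\mathbf{x}_t+\mathbf{B}\mathbf{u}_t$; here $n=m=1$. $\rho(\cdot)$ denotes the spectral radius of a real square matrix. Linear static state feedback: $\mathbf{u}_t=\mathbf{K}\mathbf{x}_t$ with $\mathbf{K}\in\mathbb{R}^{m\times n}$. A pair $(\mathbf{A}_1,\mathbf{B}_1),(\mathbf{A}_2,\mathbf{B}_2)$ is co-stabilizable by linear static state feedback if there is a single $\mathbf{K}\in\mathbb{R}^{m\times n}$ with $\rho(\mathbf{A}_i+\mathbf{B}_i\mathbf{K})<1$ for both $i=1,2$. Linear dynamic state feedback: $\mathbf{z}_{t+1}=\mathbf{F}\mathbf{z}_t+\mathbf{G}\mathbf{x}_t$, $\mathbf{u}_t=\mathbf{H}\mathbf{z}_t+\mathbf{K}\mathbf{x}_t$, where $\mathbf{z}_t\in\mathbb{R}^p$, $\mathbf{F}\in\mathbb{R}^{p\times p}$, $\mathbf{G}\in\mathbb{R}^{p\times n}$, $\mathbf{H}\in\mathbb{R}^{m\times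 p}$, $\mathbf{K}\in\mathbb{R}^{m\times n}$. The pair is co-stabilizable by linear dynamic state feedback if there exist an integer $p\ge 0$ and real matrices $(\mathbf{K},\mathbf{H},\mathbf{G},\mathbf{F})$ of these sizes (the same for both systems) such that $\rho\!\left(\begin{bmatrix}\mathbf{A}_i+\mathbf{B}_i\mathbf{K} & \mathbf{B}_i\mathbf{H}\\ \mathbf{G}&\mathbf{F}\end{bmatrix}\right)<1$ for both $i=1,2$. *)

(* Defs.v *)
From HB Require Import structures.
From mathcomp Require Import all_boot all_order all_algebra.
From mathcomp Require Import complex.
From mathcomp Require Import classical_sets reals.

Set Implicit Arguments.
Unset Strict Implicit.
Unset Printing Implicit Defensive.

Import Order.TTheory GRing.Theory Num.Theory.

Local Open Scope ring_scope.
Local Open Scope complex_scope.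
Local Open Scope classical_set_scope.

(* The eigenvalues are the complex ones.  The set is finite, and nonempty for
   n > 0, so its supremum is a maximum; for n = 0 it is empty and
   [sup set0 = 0]. *)
Definition spectral_radius (R : realType) (n : nat) (A : 'M[R]_n) : R :=
  sup [set r : R | exists2 z : R[i],
         eigenvalue (map_mx (real_complex R) A) z & r = ComplexField.Normc.normc z].

(* x_(t+1) = A x_t + B u_t, with n states and m inputs. *)
Record lti_system (R : realType) (n m : nat) := LtiSystem {
  state_mx : 'M[R]_n;
  input_mx : 'M[R]_(n, m)
}.

(* u_t = K x_t *)
Definition static_closed_loop (R : realType) (n m : nat)
    (S : lti_system R n m) (K : 'M[R]_(m, n)) : 'M[R]_n :=
  state_mx S + input_mx S *m K.

(* z_(t+1) = F z_t + G x_t and u_t = H z_t + K x_t; the closed-loop state is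
   (x_t, z_t). *)
Definition dynamic_closed_loop (R : realType) (n m p : nat)
    (S : lti_system R n m) (K : 'M[R]_(m, n)) (H : 'M[R]_(m, p))
    (G : 'M[R]_(p, n)) (F : 'M[R]_p) : 'M[R]_(n + p) :=
  block_mx (state_mx S + input_mx S *m K) (input_mx S *m H)
           G                              F.

Definition static_costabilizable (R : realType) (n m : nat)
    (S1 S2 : lti_system R n m) : Prop :=
  exists K : 'M[R]_(m, n),
    spectral_radius (static_closed_loop S1 K) < 1 /\
    spectral_radius (static_closed_loop S2 K) < 1.

Definition dynamic_costabilizable (R : realType) (n m : nat)
    (S1 S2 : lti_system R n m) : Prop :=
  exists (p : nat) (K : 'M[R]_(m, n)) (H : 'M[R]_(m, p))
         (G : 'M[R]_(p, n)) (F : 'M[R]_p),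
    spectral_radius (dynamic_closed_loop S1 K H G F) < 1 /\
    spectral_radius (dynamic_closed_loop S2 K H G F) < 1.

(* x_(t+1) = a x_t + b u_t *)
Definition scalar_system (R : realType) (a b : R) : lti_system R 1 1 :=
  LtiSystem a%:M b%:M.

(* Main.v *)
(** Both closed loops share the matrix [a - M] up to the sign of the first
    row, so their characteristic polynomials take opposite values at [a].  But a
    real monic Schur polynomial has no real root outside ]-1, 1[, so its sign on
    [1, +oo[ and on ]-oo, -1] is determined by its degree alone. *)
Require Import Defs.
From mathcomp Require Import all_boot all_order all_algebra.
From mathcomp Require Import complex polyrcf.
From mathcomp Require Import reals.
Import Order.TTheory GRing.Theory Num.Theory.
Local Open Scope ring_scope.

Lemma horner_char_poly (R : comNzRingType) (n : nat) (M : 'M[R]_n) (x : R) :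
  (char_poly M).[x] = \det (x%:M - M).
Proof.
rewrite /char_poly -horner_evalE -det_map_mx; congr (\det _).
by apply/matrixP=> i j; rewrite !mxE /= /horner_eval hornerD hornerN hornerMn hornerX hornerC.
Qed.

(** A monic polynomial is positive far to the right, so a nonpositive value at [t] would force, by
    the intermediate value theorem, a root at or beyond [t]. *)
Lemma det_sub_scalar_gt0 (R : rcfType) (n : nat) (M : 'M[R]_n) (t : R) :
  (forall x, eigenvalue M x -> x < t) -> 0 < \det (t%:M - M).
Proof.
move=> Mlt; rewrite -horner_char_poly ltNge; apply/negP => pt_le0.
have lc1 : lead_coef (char_poly M) = 1 by apply/eqP/char_poly_monic.
have [|N pN] := @poly_pinfty_gt_lc _ (char_poly M); first by rewrite lc1.
have le_tm : t <= Num.max t N by rewrite le_max lexx.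
have pm_ge0 : 0 <= (char_poly M).[Num.max t N].
  by rewrite (le_trans _ (pN _ _)) ?lc1// le_max lexx orbT.
have [x /andP[tx _]] :=
  @Num.poly_ivt _ _ _ _ le_tm (introT andP (conj pt_le0 pm_ge0)).
by rewrite -eigenvalue_root_char => /Mlt; rewrite ltNge tx.
Qed.

Lemma normc_eigenvalue_le (R : realType) (n : nat) (M : 'M[R]_n) (z : R[i]) :
  eigenvalue (map_mx (real_complex R) M) z ->
  ComplexField.Normc.normc z <= spectral_radius M.
Proof.
move=> Mz; apply: ub_le_sup; last by exists z.
have [rs p_rs] := closed_field_poly_normal
  (char_poly (map_mx (real_complex R) M)).
(* A supremum bounds its set only if the set is bounded above; the sum of the moduli of all roots is
   a crude bound. *)
exists (\sum_(w <- rs) ComplexField.Normc.normc w) => _ [w + ->].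
rewrite eigenvalue_root_char p_rs (eqP (char_poly_monic _)) scale1r.
rewrite root_prod_XsubC => w_rs; rewrite (big_rem w)//= lerDl.
by apply: sumr_ge0 => -[x y] _; apply: sqrtr_ge0.
Qed.

Lemma real_eigenvalue_le (R : realType) (n : nat) (M : 'M[R]_n) (x : R) :
  eigenvalue M x -> `|x| <= spectral_radius M.
Proof.
rewrite -(eigenvalue_map (real_complex R)) => /normc_eigenvalue_le.
by rewrite /= expr0n addr0 sqrtr_sqr.
Qed.

Lemma det_sub_scalar_same_sign (R : realType) (n : nat) (M1 M2 : 'M[R]_n)
    (a : R) :
  1 <= `|a| -> spectral_radius M1 < 1 -> spectral_radius M2 < 1 ->
  0 < \det (a%:M - M1) * \det (a%:M - M2).
Proof.
move=> a_ge1.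
have a_neq0 : a != 0 by rewrite -normr_gt0 (lt_le_trans ltr01).
have sgK : Num.sg a * Num.sg a = 1 by rewrite -expr2 sqr_sg a_neq0.
(* Scaling by the sign of [a] turns [a%:M - M] into [|a|%:M - sg a *: M], so that [a <= -1] is
   treated like [a >= 1]. The factor [sg a ^+ n] does not depend on [M] and squares to 1 in the
   final product. *)
have sg_det (M : 'M[R]_n) : spectral_radius M < 1 ->
    0 < Num.sg a ^+ n * \det (a%:M - M).
  move=> M_lt1; rewrite -detZ scalerBr scale_scalar_mx -normrEsg.
  apply: det_sub_scalar_gt0 => x /eigenvalueP[v vM v_neq0].
  apply: le_lt_trans (lt_le_trans M_lt1 a_ge1).
  rewrite (le_trans (ler_norm x))//.
  have <- : `|Num.sg a * x| = `|x| by rewrite normrM normr_sg a_neq0 mul1r.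
  (* Since [sg a] is its own inverse, [v] is also an eigenvector of [M], for [sg a * x]. *)
  apply: real_eigenvalue_le; apply/eigenvalueP; exists v => //.
  by rewrite -scalerA -vM -scalemxAr scalerA sgK scale1r.
move=> /sg_det M1_gt0 /sg_det M2_gt0; have := mulr_gt0 M1_gt0 M2_gt0.
by rewrite mulrACA -exprMn sgK expr1n mul1r.
Qed.

(** [D] stands for the sign flip relating the two closed loops: with [\det D = -1] the product of
    the two determinants is minus a square, hence not positive. *)
Lemma not_both_schur (R : realType) (n : nat) (D M1 M2 : 'M[R]_n) (a : R) :
  1 <= `|a| -> \det D = -1 -> a%:M - M2 = D *m (a%:M - M1) ->
  ~ (spectral_radius M1 < 1 /\ spectral_radius M2 < 1).
Proof.
move=> a_ge1 detD M21 [M1_lt1 M2_lt1].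
have := @det_sub_scalar_same_sign _ _ _ _ _ a_ge1 M1_lt1 M2_lt1.
by rewrite M21 det_mulmx detD mulN1r mulrN oppr_gt0 ltNge -expr2 sqr_ge0.
Qed.

Theorem theorem2 (R : realType) (a b : R) (ha : 1 <= `|a|) (hb : 0 < b) :
  ~ static_costabilizable (scalar_system a b) (scalar_system a (- b)) /\
  ~ dynamic_costabilizable (scalar_system a b) (scalar_system a (- b)).
Proof.
split=> [[K]|[p [K [H [G [F]]]]]].
  apply: (@not_both_schur _ _ (-1)%:M _ _ _ ha); first by rewrite det_scalar1.
  rewrite /static_closed_loop /= !mul_scalar_mx.
  by rewrite !opprD !addrA !subrr !add0r scaleN1r scaleNr.
(* In the first block row [a] cancels, leaving [-bK] and [-bH], both odd in [b]; the controller row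
   is the same for both systems. *)
apply: (@not_both_schur _ _ (block_mx (-1)%:M 0 0 1%:M) _ _ _ ha).
  by rewrite det_ublock det_scalar1 det1 mulr1.
rewrite /dynamic_closed_loop /= scalar_mx_block !opp_block_mx !add_block_mx.
rewrite mulmx_block !mul0mx !mul1mx !mul_scalar_mx !addr0 !add0r !scaleN1r.
by rewrite !opprD !addrA !subrr !add0r !scaleNr !opprK.
Qed.
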